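(* For every error value $\eta_1>0$ there exists an instance of Online Facility Location with predictions (a probability distribution over demand sequences together with predictions), with total $\ell_1$ prediction error equal to $\eta_1$, such that no (randomized) online algorithm using these predictions achieves competitive ratio better than $$\Omega\!\left(\frac{\log(\mathrm{err}_\infty)}{\log\left(\mathrm{err}_1^{-1}\log(\mathrm{err}_\infty)\right)}\right),$$ where $\mathrm{err}_\infty=\frac{n\,\eta_\infty}{f}$, $\mathrm{err}_1=\frac{\eta_1}{f}$ and $n$ is the number of demands.
   Context: Online Facility Location: a metric space $(\mathcal M,d)$ and uniform facility opening cost $f>0$; demands arrive one by one and must be connected upon arrival to an open facility (paying the distance); facilities cost $f$ each and are never closed. The competitive ratio compares the algorithm's expected cost to the optimal offline cost. With each demand $x$ the algorithm receives a prediction $\hat f_x\in\mathcal M$ of the facility $c^*_x$ serving $x$ in an optimal offline solution; $\eta_x=d(\hat f_x,c^*_x)$, $\eta_1=\sum_x\eta_x$, $\eta_\infty=\max_x\eta_x$. *)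

(* Defs.v *)
From HB Require Import structures.
From mathcomp Require Import all_boot all_order all_algebra.
From mathcomp Require Import boolp classical_sets reals ereal measure
  lebesgue_measure lebesgue_integral probability exp.

Set Implicit Arguments.
Unset Strict Implicit.
Unset Printing Implicit Defensive.

Import Order.TTheory GRing.Theory Num.Theory.
Local Open Scope ring_scope.

Definition is_metric {R : realType} {M : Type} (d : M -> M -> R) : Prop :=
  (forall x y, 0 <= d x y) /\
  (forall x y, d x y = 0 <-> x = y) /\
  (forall x y, d x y = d y x) /\
  (forall x y z, d x z <= d x y + d y z).

(** An input is a sequence of pairs (demand x, predicted facility \hat f_x).
    A deterministic online algorithm maps the history of (demand, prediction)
    pairs seen so far (the last one being the current demand) to
    (list of new facilities opened now, index of the facility -- in the list
    of all facilities opened so far, in opening order, including the ones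
    just opened -- to which the current demand is connected).
    Since it only sees the prefix, it is online; facilities are never closed. *)
Definition online_alg (M : Type) := seq (M * M) -> seq M * nat.

Definition opened_upto {M : Type} (A : online_alg M) (inp : seq (M * M)) (j : nat)
  : seq M :=
  flatten [seq (A (take i.+1 inp)).1 | i <- iota 0 j.+1].

Definition alg_feasible {M : Type} (A : online_alg M) (inp : seq (M * M)) : Prop :=
  forall j, (j < size inp)%N ->
    ((A (take j.+1 inp)).2 < size (opened_upto A inp j))%N.

Definition alg_cost {R : realType} {M : Type} (d : M -> M -> R) (f : R)
  (A : online_alg M) (inp : seq (M * M)) : R :=
  f *+ size (flatten [seq (A (take i.+1 inp)).1 | i <- iota 0 (size inp)])
  + \sum_(j < size inp)
      let p := tnth (in_tuple inp) j in
      d p.1 (nth p.1 (opened_upto A inp j) (A (take j.+1 inp)).2).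

(** Offline solution: facility list F and assignment a (demand j served by
    the facility nth F (a j)). *)
Definition sol_valid {M : Type} (n : nat) (F : seq M) (a : seq nat) : Prop :=
  size a = n /\ all (fun k => (k < size F)%N) a.

Definition sol_cost {R : realType} {M : Type} (d : M -> M -> R) (f : R)
  (xs : seq M) (F : seq M) (a : seq nat) : R :=
  f *+ size F +
  \sum_(j < size xs)
     let x := tnth (in_tuple xs) j in d x (nth x F (nth 0%N a j)).

Definition sol_optimal {R : realType} {M : Type} (d : M -> M -> R) (f : R)
  (xs : seq M) (F : seq M) (a : seq nat) : Prop :=
  sol_valid (size xs) F a /\
  forall F' a', sol_valid (size xs) F' a' ->
    sol_cost d f xs F a <= sol_cost d f xs F' a'.

(** An instance: input (demands with predictions) plus a designated optimal
    offline solution (c^*_x = nth F (a x)) w.r.t. which errors are measured. *)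
Record ofl_instance (M : Type) := OflInstance {
  inp : seq (M * M);
  opt_fac : seq M;
  opt_asg : seq nat }.

Definition demands {M : Type} (I : ofl_instance M) : seq M := map fst (inp I).

Definition opt_cost {R : realType} {M : Type} (d : M -> M -> R) (f : R)
  (I : ofl_instance M) : R := sol_cost d f (demands I) (opt_fac I) (opt_asg I).

Definition instance_ok {R : realType} {M : Type} (d : M -> M -> R) (f : R)
  (I : ofl_instance M) : Prop :=
  sol_optimal d f (demands I) (opt_fac I) (opt_asg I).

Definition pred_err {R : realType} {M : Type} (d : M -> M -> R)
  (I : ofl_instance M) (j : 'I_(size (inp I))) : R :=
  let p := tnth (in_tuple (inp I)) j in
  d p.2 (nth p.1 (opt_fac I) (nth 0%N (opt_asg I) j)).

Arguments pred_err {R M} d I j.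

Definition eta_1 {R : realType} {M : Type} (d : M -> M -> R)
  (I : ofl_instance M) : R := \sum_(j < size (inp I)) pred_err d I j.

Definition eta_inf {R : realType} {M : Type} (d : M -> M -> R)
  (I : ofl_instance M) : R := \big[Num.max/0]_(j < size (inp I)) pred_err d I j.

Definition all_seq {T : Type} (P : T -> Prop) (s : seq T) : Prop :=
  foldr (fun x acc => P x /\ acc) True s.

(* Main.v *)
(** Demands walk down a uniformly random root-to-leaf path of the complete binary
    tree of depth h, with m^i demands at the node of level i, each predicted at its
    own location; leaving the subtree of a node of level i+1 costs at least D / m^i.
    Each level contributes only D to the cost of serving everything from the leaf,
    and only D to the prediction error, but m D = f to an algorithm with no facility
    in the current subtree.  A facility opened early lies in the next subtree with
    probability at most 1/2, so an online algorithm pays at least h f / 2 on average,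
    while the optimum is f + h D <= 2 f.  With m = h^2 and D = f / h^2 one has
    log err_inf ~ 2 h log h, hence the claimed ratio is O(h) once h is large compared
    with f / eta_1 and eta_1 / f.  The error budget left over, eta_1 - (h - 1) D, goes
    to the prediction of the single demand at the root. *)
Require Import Defs.
From HB Require Import structures.
From mathcomp Require Import all_boot all_order all_algebra.
From mathcomp Require Import boolp classical_sets reals ereal measure
  lebesgue_measure lebesgue_integral probability exp.
From mathcomp Require Import functions measurable_realfun.
From mathcomp Require Import ring lra.
Set Implicit Arguments.
Unset Strict Implicit.
Unset Printing Implicit Defensive.

Import Order.TTheory GRing.Theory Num.Theory.
Local Open Scope ring_scope.

(* [m ^ - l], with [l] the length of the longest common prefix, for [x <> y]. *)
Fixpoint tree_dist {R : realType} (m : nat) (x y : seq bool) : R :=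
  match x, y with
  | [::], [::] => 0
  | a :: x', b :: y' => if a == b then tree_dist m x' y' / m%:R else 1
  | _, _ => 1
  end.

(** * Tree ultrametric on bit strings, and its extension by a decoy point *)

Section TreeDist.
Context {R : realType} (m : nat).
Hypothesis m_gt0 : (0 < m)%N.
Implicit Types (x y z v w : seq bool).
Local Notation td := (@tree_dist R m).

Let m_ge1 : 1 <= m%:R :> R. Proof. by rewrite ler1n. Qed.
Let m_pos : 0 < m%:R :> R. Proof. by rewrite ltr0n. Qed.

Lemma tree_dist_ge0 x y : 0 <= td x y.
Proof.
elim: x y => [|a x IH] [|b y] //=; case: ifP => // _.
by rewrite divr_ge0 // ler0n.
Qed.

Lemma tree_dist_le1 x y : td x y <= 1.
Proof.
elim: x y => [|a x IH] [|b y] //=; case: ifP => // _.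
by rewrite ler_pdivrMr // mul1r (le_trans (IH y)).
Qed.

Lemma tree_distC x y : td x y = td y x.
Proof. by elim: x y => [|a x IH] [|b y] //=; rewrite eq_sym IH. Qed.

Lemma tree_dist_eq0 x y : (td x y == 0) = (x == y).
Proof.
elim: x y => [|a x IH] [|b y] //=; rewrite ?eqxx ?oner_eq0 //.
rewrite eqseq_cons; case: (a == b) => /=; last by rewrite oner_eq0.
by rewrite mulf_eq0 invr_eq0 (gt_eqF m_pos) orbF IH.
Qed.

(** If the first letters of [x] and [y] differ, [td x y] is already the maximum 1; if they agree and
    [z] differs, [td y z] is; otherwise all three shrink by the same factor [m]. *)
Lemma tree_dist_ultra x y z : (td x z <= td x y) || (td x z <= td y z).
Proof.
elim: x y z => [|a x IH] [|b y] [|c z];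
  rewrite ?tree_dist_le1 ?orbT //= ?lexx ?ler01 ?orbT //.
have [<-|nab] := eqVneq a b.
  case: ifP => _; last by rewrite lexx orbT.
  by rewrite !(ler_pM2r (x := m%:R^-1)) ?invr_gt0 // IH.
case: ifP => [_|]; last by rewrite lexx.
by rewrite ler_pdivrMr // mul1r (le_trans (tree_dist_le1 _ _)).
Qed.

Lemma tree_dist_cat v w : w != [::] -> td v (v ++ w) = (m%:R ^+ size v)^-1.
Proof.
move=> w0; elim: v => [|b v IH] /=; first by case: w w0; rewrite //= expr0 invr1.
by rewrite eqxx IH exprSr invfM mulrC.
Qed.

Lemma tree_dist_sep v b y : ~~ prefix (rcons v b) y ->
  (m%:R ^+ size v)^-1 <= td (rcons v b) y.
Proof.
elim: v y => [|a v IH] [|c y] //=; rewrite ?expr0 ?invr1 ?lexx //.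
- by rewrite prefix0s; case: eqP.
- by move=> _; rewrite invf_le1 ?exprn_gt0 // exprn_ege1.
case: ifP => [_|_ _]; last by rewrite invf_le1 ?exprn_gt0 // exprn_ege1.
by move=> /IH h; rewrite exprSr invfM ler_pM2r ?invr_gt0.
Qed.

End TreeDist.

(* [None] is a decoy location, used only as the prediction of the root demand. *)
Definition star_dist {R : realType} (m : nat) (D L : R) (x y : option (seq bool)) : R :=
  match x, y with
  | Some x', Some y' => D * tree_dist m x' y'
  | None, None => 0
  | _, _ => L
  end.

(** Inside the tree the triangle inequality follows from the ultrametric one; a detour through the
    decoy costs [2 L], more than any tree distance since [D <= L]. *)
Lemma star_dist_metric (R : realType) (m : nat) (D L : R) :
  (0 < m)%N -> 0 < D -> D <= L -> is_metric (star_dist m D L).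
Proof.
move=> m0 D0 DL; have L0 : 0 < L by exact: lt_le_trans DL.
have tg := @tree_dist_ge0 R m; have tl := @tree_dist_le1 R m m0.
split; [|split; [|split]].
- by move=> [x|] [y|] //=; rewrite ?(ltW L0) // mulr_ge0 ?tg // ltW.
- move=> [x|] [y|] //=; split=> // /eqP; rewrite ?(gt_eqF L0) //.
    by rewrite mulf_eq0 (gt_eqF D0) tree_dist_eq0 //= => /eqP->.
  by move=> /eqP[->]; apply/eqP; rewrite mulf_eq0 tree_dist_eq0 // eqxx orbT.
- by move=> [x|] [y|] //=; rewrite tree_distC.
move=> [x|] [y|] [z|] //=; rewrite ?addr0 ?add0r ?(ltW L0) ?addr_ge0 ?(ltW L0) //.
- rewrite -mulrDr ler_pM2l //.
  by have /orP[/le_trans->|/le_trans->] := @tree_dist_ultra R m m0 x y z;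
    rewrite ?lerDl ?lerDr ?tg.
- by rewrite lerDr mulr_ge0 ?tg // ltW.
- have := tl x z; rewrite -(ler_pM2l D0) mulr1; lra.
- by rewrite lerDl mulr_ge0 ?tg // ltW.
Qed.

(** * Cost accounting along prefixes of the input *)

Definition opened {M : Type} (A : online_alg M) (q : seq (M * M)) : seq M :=
  flatten [seq (A (take i.+1 q)).1 | i <- iota 0 (size q)].

Section OnlineCost.
Context {R : realType} {M : Type} (d : M -> M -> R) (f : R).
Variable A : online_alg M.
Implicit Types (p q : seq (M * M)) (x : M * M).

Lemma opened_rcons q x :
  opened A (rcons q x) = opened A q ++ (A (rcons q x)).1.
Proof.
rewrite /opened size_rcons -addn1 iotaD add0n map_cat flatten_cat /= cats0.
rewrite take_oversize ?size_rcons //; congr (flatten _ ++ _).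
apply/eq_in_map => i; rewrite mem_iota add0n => /andP[_ lti].
by rewrite -cats1 takel_cat.
Qed.

Lemma opened_cat p q : exists t, opened A (p ++ q) = opened A p ++ t.
Proof.
elim/last_ind: q => [|q x [t IH]]; first by exists [::]; rewrite !cats0.
by rewrite -rcons_cat opened_rcons IH -catA; eexists.
Qed.

Lemma opened_uptoE q j : (j < size q)%N ->
  opened_upto A q j = opened A (take j.+1 q).
Proof.
move=> ltj; rewrite /opened_upto /opened size_takel //; congr flatten.
apply/eq_in_map => i; rewrite mem_iota add0n => /andP[_ lti].
by rewrite take_takel.
Qed.

Lemma feasible_catl p q : alg_feasible A (p ++ q) -> alg_feasible A p.
Proof.
move=> feas j ltj; have ltj' : (j < size (p ++ q))%N.
  by rewrite size_cat (leq_trans ltj) ?leq_addr.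
by have := feas j ltj'; rewrite !opened_uptoE // takel_cat.
Qed.

Lemma feasible_rcons q x : alg_feasible A (rcons q x) ->
  ((A (rcons q x)).2 < size (opened A (rcons q x)))%N.
Proof.
move/(_ (size q)); rewrite size_rcons ltnSn => /(_ isT).
by rewrite opened_uptoE ?size_rcons // take_oversize ?size_rcons.
Qed.

Lemma alg_cost_rcons q x : alg_cost d f A (rcons q x) =
  alg_cost d f A q + f *+ size (A (rcons q x)).1 +
  d x.1 (nth x.1 (opened A (rcons q x)) (A (rcons q x)).2).
Proof.
pose conn q' := let y := last x q' in
  d y.1 (nth y.1 (opened A q') (A q').2).
have costE s : alg_cost d f A s =
    f *+ size (opened A s) + \sum_(0 <= j < size s) conn (take j.+1 s).
  rewrite /alg_cost big_mkord; congr (_ + _); apply: eq_bigr => j _ /=.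
  rewrite opened_uptoE // (tnth_nth x) /conn /= (take_nth x) //.
  by rewrite last_rcons.
rewrite !costE size_rcons big_nat_recr //= take_oversize ?size_rcons //.
rewrite opened_rcons size_cat mulrnDr /conn last_rcons opened_rcons.
have -> : \sum_(0 <= i < size q) conn (take i.+1 (rcons q x)) =
          \sum_(0 <= i < size q) conn (take i.+1 q).
  apply: eq_big_nat => i /andP[_ lti]; by rewrite -cats1 takel_cat.
by rewrite /conn /=; ring.
Qed.

Hypothesis d_ge0 : forall y z, 0 <= d y z.
Hypothesis f_ge0 : 0 <= f.

Lemma alg_cost_ge_opened q : f *+ size (opened A q) <= alg_cost d f A q.
Proof.
elim/last_ind: q => [|q x IH].
  by rewrite /alg_cost big_ord0 addr0.
rewrite alg_cost_rcons opened_rcons size_cat mulrnDr.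
by have := d_ge0 x.1 (nth x.1 (opened A (rcons q x)) (A (rcons q x)).2);
  rewrite opened_rcons; lra.
Qed.

Lemma alg_cost_ge0 q : 0 <= alg_cost d f A q.
Proof. by apply: le_trans (alg_cost_ge_opened q); rewrite mulrn_wge0. Qed.

(** Facilities never close, so if none lies in [T] after the [k] repetitions, none did at any
    earlier one, and each paid at least [delta]. The term [f *+ size (opened A p)] offsets openings
    already charged to [p]. *)
Lemma alg_cost_repeat (T : pred M) (delta : R) p x k : 0 <= delta ->
    (forall y, ~~ T y -> delta <= d x.1 y) ->
    alg_feasible A (p ++ nseq k x) ->
  alg_cost d f A p + f *+ size (opened A (p ++ nseq k x)) +
    (if has T (opened A (p ++ nseq k x)) then 0 else delta *+ k) <=
  alg_cost d f A (p ++ nseq k x) + f *+ size (opened A p).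
Proof.
move=> delta0 far; elim: k => [|k IH] feas.
  by rewrite cats0 mulr0n if_same addr0.
have eqs : p ++ nseq k.+1 x = rcons (p ++ nseq k x) x.
  by rewrite -[k.+1]addn1 nseqD catA cats1.
rewrite eqs in feas *; have ltA := feasible_rcons feas.
move: feas; rewrite -cats1 => /feasible_catl/IH {}IH; rewrite cats1.
have dge := d_ge0 x.1 (nth x.1 (opened A (rcons (p ++ nseq k x) x))
  (A (rcons (p ++ nseq k x) x)).2).
rewrite alg_cost_rcons {1}opened_rcons size_cat mulrnDr.
case: ifP => [_|/negbT noT].
  move: IH; case: ifP => _; last have := mulrn_wge0 k delta0; lra.
have hT : has T (opened A (p ++ nseq k x)) = false.
  by apply/negbTE; move: noT; rewrite opened_rcons has_cat negb_or => /andP[].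
have far' : delta <= d x.1 (nth x.1 (opened A (rcons (p ++ nseq k x) x))
    (A (rcons (p ++ nseq k x) x)).2).
  by apply: far; move: noT; rewrite -all_predC => /(all_nthP x.1); apply.
by move: IH; rewrite hT mulrSr; lra.
Qed.

End OnlineCost.

(** * The random-path game against an online algorithm *)

Fixpoint paths (r : nat) : seq (seq bool) :=
  if r is r'.+1 then [seq false :: w | w <- paths r'] ++ [seq true :: w | w <- paths r']
  else [:: [::]].

Fixpoint path_input (m : nat) (v w : seq bool) :
    seq (option (seq bool) * option (seq bool)) :=
  if w is b :: w' then
    let v' := rcons v b in
    nseq (m ^ size v') (Some v', Some v') ++ path_input m v' w'
  else [::].

Definition below (v : seq bool) (y : option (seq bool)) : bool :=
  if y is Some y' then prefix v y' else false.

Lemma size_paths r : size (paths r) = (2 ^ r)%N.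
Proof. by elim: r => //= r IH; rewrite size_cat !size_map IH expnS mul2n addnn. Qed.

Lemma size_in_paths r w : w \in paths r -> size w = r.
Proof.
elim: r w => [|r IH] w /=; first by rewrite inE => /eqP->.
by rewrite mem_cat => /orP[] /mapP[u /IH <- ->].
Qed.

(** The subtrees of the two children are disjoint; the inequality can be strict because of
    facilities at [v] itself. *)
Lemma count_below_split v (s : seq (option (seq bool))) :
  (count (below (rcons v false)) s + count (below (rcons v true)) s <=
   count (below v) s)%N.
Proof.
elim: s => //= y s IH; rewrite addnACA leq_add //; case: y => //= y.
elim: {IH s}v y => [|a v IH] [|b y] //=; first by rewrite !prefix0s; case: b.
by case: eqP => //= _; apply: IH.
Qed.

Section Game.
Context {R : realType} (m : nat) (D L f : R).
Hypotheses (m_gt0 : (0 < m)%N) (D_gt0 : 0 < D) (D_le_L : D <= L).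
Hypothesis mD : m%:R * D = f.
Variable A : online_alg (option (seq bool)).
Local Notation cost := (alg_cost (star_dist m D L) f A).

Lemma far_outside_subtree v b y : ~~ below (rcons v b) y ->
  D / m%:R ^+ size v <= star_dist m D L (Some (rcons v b)) y.
Proof.
case: y => [y|] /= h; first by rewrite ler_pM2l // tree_dist_sep.
apply: le_trans D_le_L; rewrite ler_pdivrMr ?exprn_gt0 ?ltr0n //.
by rewrite ler_peMr ?(ltW D_gt0) // exprn_ege1 // ler1n.
Qed.

(** Serving the whole batch from outside the subtree costs [m D = f], as much as opening a facility.
    Thus at least [f] is paid unless a facility was already inside, and the potential term on the
    right covers that case. *)
Lemma level_cost p v b
    (q := p ++ nseq (m ^ size (rcons v b)) (Some (rcons v b), Some (rcons v b))) :
  alg_feasible A q ->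
  cost p + f / 2 * (1 + (count (below (rcons v b)) (opened A q))%:R)
    <= cost q + f * (count (below (rcons v b)) (opened A p))%:R.
Proof.
move=> feas.
have m0 : 0 < m%:R :> R by rewrite ltr0n.
have [d_ge0 _] := star_dist_metric m_gt0 D_gt0 D_le_L.
have f_gt0 : 0 < f by rewrite -mD mulr_gt0.
set T := below (rcons v b).
have := alg_cost_repeat f d_ge0 (T := T)
  (x := (Some (rcons v b), Some (rcons v b))) (divr_ge0 (ltW D_gt0)
  (exprn_ge0 (size v) (ltW m0))) (@far_outside_subtree v b) feas.
rewrite -/q.
have -> : D / m%:R ^+ size v *+ m ^ size (rcons v b) = f.
  rewrite -mulr_natr natrX size_rcons exprSr -mD; field.
  by rewrite expf_neq0 // gt_eqF.
have [t qE] := opened_cat A p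
  (nseq (m ^ size (rcons v b)) (Some (rcons v b), Some (rcons v b))).
rewrite -/q in qE; rewrite qE has_cat size_cat count_cat mulrnDr natrD.
have tT : ((count T t)%:R : R) <= (size t)%:R by rewrite ler_nat count_size.
have ct := ler0n R (count T t); have cp := ler0n R (count T (opened A p)).
case: ifP => [hasT|_] h.
  have : f * (1 + ((count T (opened A p))%:R + (count T t)%:R)) <=
         f * (2 * ((size t)%:R + (count T (opened A p))%:R)).
    rewrite ler_pM2l //.
    by move: hasT; rewrite !has_count -!(ler_nat R) => /orP[]; lra.
  by move: h; rewrite -!(mulr_natr f); lra.
have : f * (count T t)%:R <= f * (size t)%:R by rewrite ler_pM2l.
have := mulr_ge0 (ltW f_gt0) ct; have := mulr_ge0 (ltW f_gt0) cp.
by move: h; rewrite -!(mulr_natr f); lra.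
Qed.

(* The number of facilities below the current node is the potential: it halves on
   average when the next bit is drawn, and increasing it costs [f] per unit. *)
Lemma game_bound r p v :
  (forall w, w \in paths r -> alg_feasible A (p ++ path_input m v w)) ->
  2 ^+ r * (cost p + f / 2 * (r%:R - (count (below v) (opened A p))%:R)) <=
  \sum_(w <- paths r) cost (p ++ path_input m v w).
Proof.
have f_gt0 : 0 < f by rewrite -mD mulr_gt0 // ltr0n.
elim: r p v => [|r IH] p v feas.
  rewrite big_seq1 /= cats0 expr0 mul1r sub0r mulrN gerDl oppr_le0.
  by rewrite mulr_ge0 ?ler0n // divr_ge0 // ltW.
pose q b := p ++ nseq (m ^ size (rcons v b)) (Some (rcons v b), Some (rcons v b)).
have half b : (forall w, w \in paths r -> (b :: w) \in paths r.+1) ->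
    2 ^+ r * (cost p + f / 2 * (r.+1%:R -
      2 * (count (below (rcons v b)) (opened A p))%:R)) <=
    \sum_(w <- paths r) cost (p ++ path_input m v (b :: w)).
  move=> sub.
  have feas_q w : w \in paths r -> alg_feasible A (q b ++ path_input m (rcons v b) w).
    by move=> /sub/feas /=; rewrite catA.
  have -> : \sum_(w <- paths r) cost (p ++ path_input m v (b :: w)) =
            \sum_(w <- paths r) cost (q b ++ path_input m (rcons v b) w).
    by apply: eq_bigr => w _; rewrite /= catA.
  apply: le_trans (IH _ _ feas_q); rewrite ler_pM2l ?exprn_gt0 //.
  (* Feasibility is only given on complete paths, so the prefix [q b] inherits it from some
     completion. *)
  have [w0 w0P] : exists w, w \in paths r.
    by exists (nth [::] (paths r) 0); rewrite mem_nth // size_paths expn_gt0.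
  have := @level_cost p v b (feasible_catl (feas_q w0 w0P)).
  by rewrite -/(q b) -[r.+1%:R]natr1; lra.
rewrite /= big_cat !big_map /=.
have [hF hT] : (forall w, w \in paths r -> (false :: w) \in paths r.+1) /\
    (forall w, w \in paths r -> (true :: w) \in paths r.+1).
  by split=> w wP; rewrite /= mem_cat map_f ?orbT.
apply: le_trans (lerD (half false hF) (half true hT)).
rewrite -mulrDr exprSr -mulrA ler_pM2l ?exprn_gt0 //.
(* Averaging the two branches turns twice the child counts into their sum, at most the count below
   [v]. *)
have := count_below_split v (opened A p); rewrite -(ler_nat R) natrD.
set x := (count _ _)%:R; set y := (count _ _)%:R; set z := (count _ _)%:R => h.
have : f * (x + y) <= f * z by rewrite ler_pM2l.
lra.
Qed.

End Game.

(** * Optimality of a single facility at the majority point *)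

Lemma sol_cost1 (R : realType) (M : Type) (d : M -> M -> R) (f : R) (xs : seq M)
    (y : M) (a : seq nat) : sol_valid (size xs) [:: y] a ->
  sol_cost d f xs [:: y] a = f + \sum_(x <- xs) d x y.
Proof.
case=> sza /all_nthP alla; rewrite /sol_cost /= mulr1n; congr (_ + _).
rewrite (big_tnth _ _ xs) /=; apply: eq_bigr => j _.
by have := alla 0%N j; rewrite sza ltn_ord => /(_ isT); case: (nth _ a j).
Qed.

(* Pairing every demand off the majority point [s] with one at [s], the triangle
   inequality shows that [s] is a 1-median; two facilities already cost more. *)
Lemma majority_point_optimal (R : realType) (M : eqType) (d : M -> M -> R) (f : R)
    (xs : seq M) (s : M) : is_metric d -> (0 < size xs)%N ->
    (size xs <= 2 * count_mem s xs)%N -> \sum_(x <- xs) d x s <= f ->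
  sol_optimal d f xs [:: s] (nseq (size xs) 0%N).
Proof.
move=> [d_ge0 [d_eq0 [dC d_tri]]] xs0 maj sumf.
have f_ge0 : 0 <= f by apply: le_trans sumf; apply: sumr_ge0.
have valid1 : sol_valid (size xs) [:: s] (nseq (size xs) 0%N).
  by split; rewrite ?size_nseq // all_nseq orbT.
split=> // F a validFa; rewrite sol_cost1 //.
case: F validFa => [|y [|z F]] validFa.
- by case: validFa => sza; case: a xs0 sza => [|k a]; rewrite //= => /[swap] <-.
- rewrite sol_cost1 // lerD2l.
  have key (t : seq M) : \sum_(x <- t) d x s + d s y *+ (2 * count_mem s t) <=
      \sum_(x <- t) d x y + d s y *+ size t.
    elim: t => [|x t IH]; first by rewrite !big_nil.
    rewrite !big_cons /= mulnDr mulrnDr [in leRHS]mulrS.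
    have [->|_] := eqVneq x s.
      by rewrite (proj2 (d_eq0 s s) erefl) muln1 mulr2n; lra.
    by rewrite muln0 mulr0n; have := d_tri x y s; rewrite (dC y s); lra.
  have : d s y *+ size xs <= d s y *+ (2 * count_mem s xs) by apply: ler_wpMn2l.
  by have := key xs; lra.
- rewrite /sol_cost /= !mulrS.
  set S := \sum_(_ < _) _; have S0 : 0 <= S by apply: sumr_ge0.
  have : 0 <= f *+ size F by rewrite mulrn_wge0.
  by move: sumf; lra.
Qed.

(** * Size, optimum and prediction errors of the hard instances *)

Lemma size_path_input m v w :
  size (path_input m v w) = (\sum_(j < size w) m ^ (size v + j.+1))%N.
Proof.
elim: w v => [|b w IH] v /=; first by rewrite big_ord0.
rewrite size_cat size_nseq IH big_ord_recl addn1 size_rcons; congr (_ + _)%N.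
by apply: eq_bigr => j _; rewrite addSnnS.
Qed.

(** The extra 1 is the root demand: the last batch makes up at least half of all demands, so the
    leaf is a majority point. *)
Lemma geometric_le_double m r : (1 < m)%N ->
  ((\sum_(j < r) m ^ j.+1).+1 <= 2 * m ^ r)%N.
Proof.
move=> m1; elim: r => [|r IH]; first by rewrite big_ord0.
rewrite big_ord_recr /= -addSn.
rewrite [leqRHS]mul2n -addnn leq_add2r (leq_trans IH) //.
by rewrite expnS leq_mul2r m1 orbT.
Qed.

Lemma count_leaf_path_input m v w : w != [::] ->
  (m ^ (size v + size w) <= count_mem (Some (v ++ w)) (map fst (path_input m v w)))%N.
Proof.
elim: w v => // b w IH v _ /=.
rewrite map_cat count_cat map_nseq /= -cat_rcons addnS -addSn -(size_rcons v b).
case: w IH => [|c w] IH.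
  by rewrite cats0 addn0 count_nseq /= eqxx mul1n leq_addr.
by apply: leq_trans (IH (rcons v b) _) _; rewrite ?leq_addl.
Qed.

Lemma path_input_ind m (P : option (seq bool) * option (seq bool) -> Prop) :
  (forall y, P (Some y, Some y)) -> forall v w p, p \in path_input m v w -> P p.
Proof.
move=> HP v w; elim: w v => [|b w IH] v p //=.
by rewrite mem_cat => /orP[/nseqP[-> _]|/IH].
Qed.

Section InstanceCost.
Context {R : realType} (m : nat) (D L : R).
Hypothesis m_gt0 : (0 < m)%N.
Local Notation dist := (star_dist m D L).

(** A batch of [m ^ i] demands at distance [D / m ^ i] contributes [D]; the batch at the leaf
    contributes 0, hence the predecessor. *)
Lemma sum_dist_path_input v w :
  \sum_(p <- path_input m v w) dist p.1 (Some (v ++ w)) = D *+ (size w).-1.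
Proof.
elim: w v => [|b w IH] v; first by rewrite big_nil.
rewrite big_cat big_nseq iter_addr_0 /= -cat_rcons IH.
case: w {IH} => [|c w] /=.
  have /eqP -> : tree_dist m (rcons v b) (rcons v b ++ [::]) == 0 :> R.
    by rewrite tree_dist_eq0 // cats0.
  by rewrite mulr0 mul0rn addr0.
rewrite tree_dist_cat // -[D / _ *+ _]mulr_natr natrX divfK ?mulrS //.
by rewrite expf_neq0 // pnatr_eq0 -lt0n.
Qed.

End InstanceCost.

Definition path_instance (m : nat) (s : seq bool) : ofl_instance (option (seq bool)) :=
  let q := (Some [::], None) :: path_input m [::] s in
  OflInstance q [:: Some s] (nseq (size q) 0%N).

Section Instance.
Context {R : realType} (m : nat) (D L f : R) (s : seq bool).
Hypotheses (m_gt1 : (1 < m)%N) (D_gt0 : 0 < D) (D_le_L : D <= L).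
Hypotheses (s_neq0 : s != [::]) (D_le_f : D *+ size s <= f).
Local Notation dist := (star_dist m D L).
Local Notation I := (path_instance m s).

Let m_gt0 : (0 < m)%N := ltnW m_gt1.

Lemma size_path_instance :
  size (inp I) = (\sum_(j < size s) m ^ j.+1).+1.
Proof. by rewrite /= size_path_input. Qed.

Lemma sum_dist_leaf : \sum_(x <- demands I) dist x (Some s) = D *+ size s.
Proof.
rewrite /demands /= big_cons big_map -[s in Some s]cat0s sum_dist_path_input //.
have := @tree_dist_cat R m [::] s s_neq0; rewrite /= expr0 invr1 => ->.
by rewrite mulr1; case: (s) s_neq0 => //= _ t _; rewrite mulrS.
Qed.

Lemma path_instance_ok : instance_ok dist f I.
Proof.
rewrite /instance_ok.
have -> : opt_asg I = nseq (size (demands I)) 0%N.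
  by rewrite /demands size_map.
apply: majority_point_optimal.
- exact: star_dist_metric.
- by [].
- rewrite /demands size_map size_path_instance.
  apply: leq_trans (geometric_le_double _ m_gt1) _; rewrite leq_mul2l /=.
  by apply: leq_trans (count_leaf_path_input m [::] s_neq0) _; rewrite leq_addl.
- by rewrite sum_dist_leaf.
Qed.

Lemma path_instance_opt_cost : opt_cost dist f I = f + D *+ size s.
Proof.
rewrite /opt_cost sol_cost1 ?sum_dist_leaf //.
by case: path_instance_ok.
Qed.

Lemma path_instance_pred_err (j : 'I_(size (inp I))) :
  pred_err dist I j = dist (tnth (in_tuple (inp I)) j).2 (Some s).
Proof.
by rewrite /pred_err -[opt_asg _]/(nseq (size (inp I)) 0%N) nth_nseq if_same.
Qed.

(** The decoy prediction contributes [L]; every other prediction equals its demand, so the remaining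
    errors are connection distances to the leaf. *)
Lemma path_instance_eta_1 : eta_1 dist I = L + D *+ (size s).-1.
Proof.
rewrite /eta_1 (eq_bigr _ (fun j _ => path_instance_pred_err j)).
rewrite -(big_tnth _ _ (inp I) xpredT (fun p => dist p.2 (Some s))) big_cons.
congr (_ + _); rewrite -(@sum_dist_path_input R m D L m_gt0 [::] s).
by apply: eq_big_seq => p; apply: (@path_input_ind m (fun p => _ p.2 _ = _ p.1 _)).
Qed.

Lemma path_instance_eta_inf : eta_inf dist I = L.
Proof.
rewrite /eta_inf (eq_bigr _ (fun j _ => path_instance_pred_err j)).
rewrite -(big_tnth _ _ (inp I) xpredT (fun p => dist p.2 (Some s))) big_cons /=.
apply/max_idPl; rewrite big_seq; apply: bigmax_le.
  by apply: le_trans D_le_L; apply: ltW.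
move=> p; apply: (@path_input_ind m (fun p => dist p.2 (Some s) <= L)) => y /=.
by apply: le_trans D_le_L; rewrite ler_piMr ?tree_dist_le1 // ltW.
Qed.

End Instance.

(** * Averaging over the algorithm's randomness, and numerical estimates *)

Lemma all_seq_mapP (T : eqType) (U : Type) (P : U -> Prop) (g : T -> U) (s : seq T) :
  all_seq P (map g s) <-> forall x, x \in s -> P (g x).
Proof.
elim: s => [|y s IH] /=; first by split.
split=> [[Py /IH Ps] x|Ps].
  by rewrite inE => /predU1P[->|/Ps].
split; first by apply: Ps; rewrite mem_head.
by apply/IH => x xs; apply: Ps; rewrite inE xs orbT.
Qed.

(** The averaging half of Yao's principle: exchanging sum and integral reduces a randomized
    algorithm to a bound for each deterministic one. *)
Lemma sum_integral_ge (R : realType) (dO : measure_display)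
    (Omega : measurableType dO) (P : probability Omega R) (T : eqType) (s : seq T)
    (c x : R) (g : T -> Omega -> R) :
  0 <= c -> (forall t, t \in s -> measurable_fun setT (g t)) ->
  (forall t w, 0 <= g t w) -> 0 <= x -> (forall w, x <= \sum_(t <- s) c * g t w) ->
  (x%:E <= \sum_(t <- s) (c%:E * \int[P]_w (g t w)%:E))%E.
Proof.
move=> c0 mg g0 x0 lex.
(* Measurability is known only for indices in [s]; extending by 0 makes it hold for all. *)
pose g' t := if t \in s then g t else fun=> 0.
have g'E t : t \in s -> g' t = g t by rewrite /g' => ->.
have mg' t : measurable_fun setT (g' t).
  by rewrite /g'; case: ifPn => [/mg //|_]; apply: measurable_cst.
have g'0 t w : 0 <= g' t w by rewrite /g'; case: ifP.
have -> : (\sum_(t <- s) (c%:E * \int[P]_w (g t w)%:E) =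
           \int[P]_w (\sum_(t <- s) (c * g' t w)%:E))%E.
  rewrite ge0_integral_sum //.
  - apply: eq_big_seq => t ts; rewrite -ge0_integralZl_EFin //.
    + by rewrite g'E.
    + by move=> w _; rewrite lee_fin.
    + by apply/measurable_EFinP; apply: mg.
  - move=> t; apply/measurable_EFinP; apply: measurable_funM => //.
  - by move=> t w _; rewrite lee_fin mulr_ge0.
have -> : x%:E = (\int[P]_w (cst x%:E) w)%E.
  by rewrite integral_cst //= probability_setT mule1.
apply: ge0_le_integral => //.
- apply: emeasurable_sum => t; apply/measurable_EFinP.
  by apply: measurable_funM.
move=> w _; rewrite sumEFin lee_fin (le_trans (lex w)) // le_eqVlt; apply/orP; left.
by apply/eqP; apply: eq_big_seq => t ts; rewrite g'E.
Qed.

(** As [(h ^ 2) ^ h = k ^ (4 h)], the numerator is at most [6 h ln k], with slack absorbing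
    [2 a <= k]; since [ln E >= h = k ^ 2 >= a k], the denominator is at least [ln k]. *)
Lemma ln_ratio_le (R : realType) (a E : R) (k : nat) (h := (k ^ 2)%N) :
    0 < a -> (2 <= k)%N -> 2 * a <= k%:R ->
    (h%:R ^+ 2) ^+ h / h%:R ^+ 2 <= E -> E <= 2 * a * (h%:R ^+ 2) ^+ h ->
  ln E / ln (ln E / a) <= 6 * h%:R.
Proof.
move=> a0 k2 ak lowE upE.
have k2R : 2 <= k%:R :> R by rewrite ler_nat.
have k0 : 0 < k%:R :> R by lra.
have hE : h%:R = k%:R ^+ 2 :> R by rewrite /h natrX.
have h0 : 0 < h%:R :> R by rewrite hE exprn_gt0.
have h4 : 4 <= h%:R :> R by rewrite hE; nra.
have lnh : ln h%:R = 2 * ln k%:R :> R by rewrite hE lnXn // mulr_natl.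
(* Apply [ln (1 + t) <= t] at [1 + t = 1 / k]. *)
have lnk : 1 / 2 <= ln (k%:R : R).
  have : ln (1 + (k%:R^-1 - 1)) <= k%:R^-1 - 1 :> R.
    by apply: le_ln1Dx; rewrite ltrBDl subrr invr_gt0.
  rewrite addrC subrK lnV ?posrE //.
  have : (k%:R : R)^-1 <= 2^-1 by rewrite lef_pV2 ?posrE.
  lra.
have pow0 : 0 < (h%:R ^+ 2) ^+ h :> R by rewrite !exprn_gt0.
have E0 : 0 < E by apply: lt_le_trans lowE; rewrite divr_gt0 // exprn_gt0.
have lnpow : ln ((h%:R ^+ 2) ^+ h) = 4 * h%:R * ln k%:R :> R.
  rewrite -exprM lnXn // lnh -[_ *+ (2 * h)]mulr_natl natrM; ring.
have lowlnE : h%:R <= ln E.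
  have : ln ((h%:R ^+ 2) ^+ h / h%:R ^+ 2) <= ln E.
    by rewrite ler_ln ?posrE // divr_gt0 // exprn_gt0.
  rewrite ln_div ?posrE ?exprn_gt0 // lnpow lnXn // lnh.
  nra.
have uplnE : ln E <= 6 * h%:R * ln k%:R.
  have : ln E <= ln (2 * a * (h%:R ^+ 2) ^+ h).
    by rewrite ler_ln ?posrE // mulr_gt0 // mulr_gt0.
  rewrite lnM ?posrE ?mulr_gt0 // lnpow.
  have : ln (2 * a) <= ln k%:R by rewrite ler_ln ?posrE // mulr_gt0.
  nra.
have lnln : ln k%:R <= ln (ln E / a).
  have kE : k%:R <= ln E / a.
    rewrite ler_pdivlMr // (le_trans _ lowlnE) // hE; nra.
  by rewrite ler_ln ?posrE // (lt_le_trans k0).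
rewrite ler_pdivrMr; last by lra.
by apply: le_trans uplnE _; rewrite ler_pM2l // mulr_gt0.
Qed.

(** The game starts after the root demand; the potential of facilities opened by then is covered by
    their opening cost. *)
Lemma expected_path_cost_ge (R : realType) (m h : nat) (D L f : R)
    (A : online_alg (option (seq bool))) :
  (0 < m)%N -> 0 < D -> D <= L -> m%:R * D = f ->
  (forall s, s \in paths h -> alg_feasible A (inp (path_instance m s))) ->
  f / 2 * h%:R <=
  \sum_(s <- paths h) (2 ^+ h)^-1 *
    alg_cost (star_dist m D L) f A (inp (path_instance m s)).
Proof.
move=> m0 D0 DL mD feas; have f0 : 0 < f by rewrite -mD mulr_gt0 // ltr0n.
pose p : seq (option (seq bool) * option (seq bool)) := [:: (Some [::], None)].
have bound := game_bound (p := p) (v := [::]) m0 D0 DL mD feas.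
have [d_ge0 _] := star_dist_metric m0 D0 DL.
rewrite -mulr_sumr [leRHS]mulrC ler_pdivlMr ?exprn_gt0 // mulrC.
apply: le_trans bound; rewrite ler_pM2l ?exprn_gt0 //.
have := alg_cost_ge_opened f A d_ge0 p.
have : f * (count (below [::]) (opened A p))%:R <= f * (size (opened A p))%:R.
  by rewrite ler_pM2l // ler_nat count_size.
have := mulr_ge0 (ltW f0) (ler0n R (count (below [::]) (opened A p))).
rewrite -mulr_natr; lra.
Qed.

(* D = finitely supported input distribution: list of (probability, instance).
   ratio bound = c * log(err_inf) / log(err_1^{-1} log(err_inf)),
   err_inf = n eta_inf / f, err_1 = eta_1 / f; the Omega is read as: a universal
   constant c > 0, for every f, eta_1 > 0 and instances with arbitrarily large
   err_inf. A randomized algorithm is a random choice (on an arbitrary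
   probability space) of a deterministic online algorithm. *)
Theorem theorem4p1 (R : realType) :
  exists c : R, 0 < c /\
  forall (f e1 : R), 0 < f -> 0 < e1 ->
  forall N : R,
  exists (M : Type) (d : M -> M -> R) (n : nat) (einf : R)
         (D : seq (R * ofl_instance M)),
    is_metric d /\
    N <= n%:R * einf / f /\
    (0 < size D)%N /\
    all_seq (fun wI => 0 < wI.1) D /\
    \sum_(wI <- D) wI.1 = 1 /\
    all_seq (fun wI =>
       size (inp wI.2) = n /\ instance_ok d f wI.2 /\
       eta_1 d wI.2 = e1 /\ eta_inf d wI.2 = einf) D /\
    forall (dO : measure_display) (Omega : measurableType dO)
           (P : probability Omega R) (A : Omega -> online_alg M),
      (forall w, all_seq (fun wI => alg_feasible (A w) (inp wI.2)) D) ->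
      all_seq (fun wI =>
        measurable_fun setT (fun w => alg_cost d f (A w) (inp wI.2))) D ->
      ((c * (ln (n%:R * einf / f) / ln (ln (n%:R * einf / f) / (e1 / f))))%:E
         * \sum_(wI <- D) (wI.1 * opt_cost d f wI.2)%:E
       <= \sum_(wI <- D) (wI.1%:E * \int[P]_w (alg_cost d f (A w) (inp wI.2))%:E))%E.
Proof.
(* The log ratio is at most [6 h] and the optimum at most [2 f], while the algorithm pays at least
   [h f / 2]: [24 = 6 * 2 * 2]. *)
exists 24^-1; split; first by rewrite invr_gt0.
move=> f e1 f0 e10 N.
have a0 : 0 < e1 / f by rewrite divr_gt0.
(* The bound by [2 (e1 / f)] serves the logarithms, [f / e1 <= k] gives [D h = f / h <= e1] and
   hence [D <= L], and [N <= k] makes [E] reach [N]. *)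
have [k [k2 ak fk Nk]] : exists k : nat,
    [/\ (2 <= k)%N, 2 * (e1 / f) <= k%:R, f / e1 <= k%:R & N <= k%:R].
  pose x := 2 * (e1 / f) + f / e1 + `|N|.
  have fe0 : 0 < f / e1 by rewrite divr_gt0.
  have x0 : 0 <= x by have := normr_ge0 N; rewrite /x; lra.
  have := archi_boundP x0; set b := Num.bound x => /ltW xb.
  have bk : b%:R <= (b + 2)%:R :> R by rewrite ler_nat leq_addr.
  have := ler_norm N; have := normr_ge0 N; move: x0 xb; rewrite /x => *.
  by exists (b + 2)%N; split; rewrite ?leq_addl //; lra.
(* [h] is a square [k ^ 2] so that [ln E / (e1 / f) >= h / (e1 / f) >= k], which
   makes the iterated logarithm at least [ln k = ln h / 2]. *)
pose h := (k ^ 2)%N; pose m := (h ^ 2)%N.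
have k2R : 2 <= k%:R :> R by rewrite ler_nat.
have k0 : 0 < k%:R :> R by lra.
have hE : h%:R = k%:R ^+ 2 :> R by rewrite natrX.
have mE : m%:R = h%:R ^+ 2 :> R by rewrite natrX.
have kh : k%:R <= h%:R :> R by rewrite hE; nra.
have hm : h%:R <= m%:R :> R by rewrite mE; nra.
have h0 : 0 < h%:R :> R by lra.
have m_gt0 : 0 < m%:R :> R by lra.
have h1N : (1 < h)%N by rewrite -(ltr_nat R); lra.
have m1N : (1 < m)%N by rewrite -(ltr_nat R); lra.
have m0N : (0 < m)%N by exact: ltnW.
pose D := f / m%:R; pose L := e1 - D *+ h.-1.
have D0 : 0 < D by rewrite divr_gt0.
have mD : m%:R * D = f by rewrite mulrC divfK // gt_eqF.
have Dh : D *+ h = f / h%:R.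
  by rewrite -mulr_natr /D mE; field; rewrite gt_eqF.
have Dh_f : D *+ h <= f.
  by rewrite Dh ler_pdivrMr // ler_peMr ?ltW // (lt_le_trans _ kh) //; lra.
have Dh_e1 : D *+ h <= e1.
  by rewrite Dh ler_pdivrMr // -ler_pdivrMl // mulrC (le_trans fk).
have hS : h = h.-1.+1 by rewrite prednK // ltnW.
have DL : D <= L by rewrite /L; move: Dh_e1; rewrite {1}hS mulrS; lra.
have Le1 : L <= e1 by rewrite /L gerBl mulrn_wge0 // ltW.
have L0 : 0 < L by lra.
pose n := (\sum_(j < h) m ^ j.+1).+1.
have mn : (m ^ h <= n)%N.
  by rewrite /n hS big_ord_recr /= ltnW // ltnS leq_addl.
have n2 : (n <= 2 * m ^ h)%N by exact: geometric_le_double.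
set E := n%:R * L / f.
have pow0 : 0 < m%:R ^+ h :> R by rewrite exprn_gt0.
(* Here [L / f >= D / f = 1 / m]; the upper bound on [E] uses [L <= e1]. *)
have lowE : m%:R ^+ h / m%:R <= E.
  rewrite /E -mulrA ler_pM ?invr_ge0 ?(ltW m_gt0) ?(ltW pow0) //.
    by rewrite -natrX ler_nat.
  by rewrite ler_pdivlMr // mulrC.
have upE : E <= 2 * (e1 / f) * m%:R ^+ h.
  rewrite /E -mulrA mulrAC ler_pM ?divr_ge0 ?(ltW f0) ?(ltW L0) //.
    by rewrite -natrX -natrM ler_nat.
  by rewrite ler_pM2r ?invr_gt0.
have ratio : ln E / ln (ln E / (e1 / f)) <= 6 * h%:R.
  by apply: ln_ratio_le; rewrite // -/h -mE.
have NE : N <= E.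
  apply: le_trans lowE; rewrite {1}hS exprSr mulfK ?gt_eqF //.
  apply: le_trans (_ : m%:R <= _); first lra.
  by rewrite -[leLHS]expr1 ler_eXn2l ?ltr1n // -ltnS -hS.
have path_facts s : s \in paths h -> s != [::] /\ size s = h.
  move=> /size_in_paths szs; split=> //.
  by apply: contraTneq h1N => s0; rewrite -szs s0.
exists (option (seq bool)), (star_dist m D L), n, L,
  [seq ((2 ^+ h)^-1, path_instance m s) | s <- paths h].
split; first exact: star_dist_metric.
split=> //.
split; first by rewrite size_map size_paths expn_gt0.
split; first by apply/all_seq_mapP => s _; rewrite /= invr_gt0 exprn_gt0.
have weights : \sum_(s <- paths h) (2 ^+ h)^-1 = 1 :> R.
  by rewrite big_const_seq count_predT size_paths iter_addr_0 -[_^-1 *+ _]mulr_natr natrX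
     mulVf // expf_neq0.
split; first by rewrite big_map.
split.
  apply/all_seq_mapP => s /path_facts[s0 szs].
  split; first by rewrite size_path_instance szs.
  split; first by apply: path_instance_ok; rewrite ?szs.
  by rewrite path_instance_eta_1 // path_instance_eta_inf // szs subrK.
move=> dO Omega P A feas meas.
have [d_ge0 _] := star_dist_metric m0N D0 DL.
rewrite !big_map /=.
apply: le_trans (_ : (f / 2 * h%:R)%:E <= _)%E; last first.
  apply: sum_integral_ge.
  - by rewrite invr_ge0 exprn_ge0.
  - by move/all_seq_mapP : meas.
  - by move=> s w; apply: alg_cost_ge0 => //; apply: ltW.
  - by rewrite mulr_ge0 ?divr_ge0 // ltW.
  - move=> w; apply: expected_path_cost_ge => // s sP.
    by have /all_seq_mapP/(_ s sP) := feas w.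
rewrite (eq_big_seq (fun=> ((2 ^+ h)^-1 * (f + D *+ h))%:E)); last first.
  move=> s /path_facts[s0 szs].
  by rewrite path_instance_opt_cost // szs.
rewrite sumEFin -EFinM lee_fin -mulr_suml weights mul1r -/E.
have Dh0 : 0 <= D *+ h by rewrite mulrn_wge0 // ltW.
apply: le_trans (_ : 24^-1 * (6 * h%:R) * (f + D *+ h) <= _).
  by rewrite ler_wpM2r ?addr_ge0 ?(ltW f0) // ler_pM2l ?invr_gt0.
have : h%:R * (D *+ h) <= h%:R * f by rewrite ler_pM2l.
lra.
Qed.
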